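(* Let $L\in\mathbb{R}^{n\times n}$ be a Laplacian matrix and let $\bar J=(\bar J_{ij})_{n\times n}=L^\vdash$ be its eigenprojection. For $\delta>0$ let $\boldsymbol{y}(t)=(y_1(t),\ldots,y_{n+1}(t))^{\mathrm T}$, $t\ge 0$, be the solution of $$\dot{\boldsymbol{y}}(t)=-(L_0+H_{\delta,\delta\mathbf 1})\,\boldsymbol{y}(t)$$ with initial state $\boldsymbol y(0)\in\mathbb R^{n+1}$ (fixed independently of $\delta$), where $L_0$ and $H_{\delta,\delta\mathbf 1}$ are defined in the context. Then $$\lim_{t\to\infty}\boldsymbol{y}(t)=\mathbf 1'\,\frac{1}{n+1}\left(\sum_{j=1}^n s_j^\delta\, y_j(0)+y_{n+1}(0)\right),$$ $$\lim_{\delta\to+0}\,\lim_{t\to\infty}\boldsymbol{y}(t)=\mathbf 1'\,\frac{1}{n+1}\left(\sum_{j=1}^n \bar J_{\cdot j}\,y_j(0)+y_{n+1}(0)\right),$$ where $s_j^\delta$ is the $j$th column sum of the matrix $(I+\tfrac1\delta L)^{-1}$ and $\bar J_{\cdot j}=\sum_{i=1}^n\bar J_{ij}$ is the $j$th column sum of $\bar J$.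
   Context: A Laplacian matrix is a real square matrix with nonpositive off-diagonal entries and zero row sums. For a square matrix $A$ let $\nu$ be its index, i.e. the smallest $k\in\{0,1,\ldots\}$ with $\operatorname{rank}A^{k+1}=\operatorname{rank}A^k$ (where $A^0=I$); the eigenprojection $A^\vdash$ of $A$ (corresponding to the eigenvalue $0$) is the unique idempotent matrix with range $\mathcal R(A^\vdash)=\mathcal N(A^\nu)$ and null space $\mathcal N(A^\vdash)=\mathcal R(A^\nu)$. $\mathbf 1$ and $\mathbf 0$ are the all-ones and all-zeros column vectors of length $n$, $\mathbf 1'$ is the all-ones column vector of length $n+1$, $I$ is the identity matrix of order $n$. The matrices of order $n+1$ are $$L_0=\begin{pmatrix}L&\mathbf 0\\ \mathbf 0^{\mathrm T}&0\end{pmatrix},\qquad H_{\delta,\delta\mathbf 1}=\delta\begin{pmatrix}I&-\mathbf 1\\ \mathbf 0^{\mathrm T}&0\end{pmatrix}+\begin{pmatrix}0_{n\times n}&\mathbf 0\\ -\delta\mathbf 1^{\mathrm T}&\delta n\end{pmatrix}.$$ *)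

(* Defs.v *)
From mathcomp Require Import all_boot all_order all_algebra.
From mathcomp Require Import all_classical all_reals all_analysis.

Set Implicit Arguments.
Unset Strict Implicit.
Unset Printing Implicit Defensive.

Import Order.TTheory GRing.Theory Num.Theory.
Import numFieldNormedType.Exports.

Local Open Scope classical_set_scope.
Local Open Scope ring_scope.

Definition is_laplacian (R : realType) (n : nat) (L : 'M[R]_n) : Prop :=
  (forall i j : 'I_n, i != j -> L i j <= 0) /\
  (forall i : 'I_n, \sum_(j < n) L i j = 0).

Lemma laplacian_unitmx (R : realType) (n : nat) (L : 'M[R]_n) (delta : R) :
  is_laplacian L -> 0 < delta -> 1%:M + delta^-1 *: L \in unitmx.
Proof.
move=> [L_le0 L_row0] delta_gt0; set M := 1%:M + _.
have max_principle (v : 'cV[R]_n) : M *m v = 0 -> forall k, v k 0 <= 0.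
  move=> Mv0 k; case: (@arg_maxP _ _ _ k predT (fun i => v i 0) isT) => i _ vi.
  apply: le_trans (vi k isT) _.
  have -> : v i 0 = - (delta^-1 * \sum_j L i j * v j 0).
    have /matrixP/(_ i 0) := Mv0.
    by rewrite mulmxDl mul1mx -scalemxAl !mxE => /eqP; rewrite addr_eq0 => /eqP.
  rewrite oppr_le0 mulr_ge0//; first by rewrite invr_ge0 ltW.
  have -> : \sum_j L i j * v j 0 = \sum_j L i j * (v j 0 - v i 0).
    under [RHS]eq_bigr do rewrite mulrBr.
    by rewrite sumrB -mulr_suml L_row0 mul0r subr0.
  apply: sumr_ge0 => j _; have [->|neq_ij] := eqVneq i j.
    by rewrite subrr mulr0.
  by rewrite mulr_le0 ?L_le0// subr_le0; apply: vi.
rewrite -unitmx_tr -row_free_unit; apply: inj_row_free => v vM0.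
have Mv0 : M *m v^T = 0 by apply: trmx_inj; rewrite trmx_mul trmxK trmx0.
apply/rowP => k; rewrite mxE; apply/eqP; rewrite eq_le.
have := max_principle _ Mv0 k; rewrite mxE => -> /=.
have MNv0 : M *m - v^T = 0 by rewrite mulmxN Mv0 oppr0.
by have := max_principle _ MNv0 k; rewrite !mxE oppr_le0.
Qed.

Lemma mx_index_exists (F : fieldType) (n : nat) (A : 'M[F]_n) :
  exists k, \rank (A ^+ k.+1) == \rank (A ^+ k).
Proof.
apply: contrapT => /forallNP neq.
have rank_le k : (\rank (A ^+ k) + k <= n)%N.
  elim: k => [|k IH]; first by rewrite addn0 rank_leq_row.
  have : (\rank (A ^+ k.+1) <= \rank (A ^+ k))%N.
    by rewrite exprS -mulmxE mxrankM_maxr.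
  rewrite leq_eqVlt => /orP[/neq//|lt_rank].
  by rewrite (leq_trans _ IH)// addnS -addSn leq_add2r.
by have := leq_trans (leq_addl _ _) (rank_le n.+1); rewrite ltnn.
Qed.

Definition mx_index (F : fieldType) (n : nat) (A : 'M[F]_n) : nat :=
  ex_minn (mx_index_exists A).

(* Range and null space are those of the action on column vectors, whereas the
   row-space notions of mxalgebra refer to the action on row vectors. *)
Definition is_eigenprojection (F : fieldType) (n : nat) (A P : 'M[F]_n) : Prop :=
  [/\ P *m P = P,
      forall x : 'cV[F]_n,
        (exists z : 'cV[F]_n, x = P *m z) <-> A ^+ mx_index A *m x = 0
    & forall x : 'cV[F]_n,
        P *m x = 0 <-> (exists z : 'cV[F]_n, x = A ^+ mx_index A *m z)].

Lemma eigenprojection_unique (F : fieldType) (n : nat) (A P Q : 'M[F]_n) :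
  is_eigenprojection A P -> is_eigenprojection A Q -> P = Q.
Proof.
move=> [PP rP kP] [QQ rQ kQ].
suff PQ (x : 'cV[F]_n) : P *m x = Q *m x.
  apply/matrixP => i j.
  by have /matrixP/(_ i 0) := PQ (delta_mx j 0); rewrite -!colE !mxE.
have /kP/kQ : P *m (x - P *m x) = 0 by rewrite mulmxBr mulmxA PP subrr.
rewrite mulmxBr => /eqP; rewrite subr_eq0 => /eqP ->.
have /rP/rQ[z ->] : exists z, P *m x = P *m z by exists x.
by rewrite mulmxA QQ.
Qed.

Lemma eigenprojection_exists (F : fieldType) (n : nat) (A : 'M[F]_n) :
  exists P, is_eigenprojection A P.
Proof.
set nu := mx_index A; pose B := A ^+ nu.
have rank_nu : \rank (A ^+ nu.+1) = \rank B.
  by rewrite /B /nu /mx_index; case: ex_minnP => m /eqP.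
have rank_add k : \rank (A ^+ (k + nu)) = \rank B.
  elim: k => [//|k IH].
  have sub_nu : (A ^+ nu <= A ^+ nu.+1)%MS.
    have le_nu : (A ^+ nu.+1 <= A ^+ nu)%MS by rewrite exprS -mulmxE submxMl.
    by rewrite -(mxrank_leqif_sup le_nu) rank_nu.
  rewrite -IH; apply/eqP; rewrite eqn_leq addSn; apply/andP; split.
    by rewrite exprS -mulmxE mxrankM_maxr.
  rewrite -addSn addSnnS addnC [(k + _)%N]addnC !exprD -!mulmxE.
  by apply/mxrankS/submxMr.
pose U := kermx B^T; pose V := B^T.
have capUV : (U :&: V = 0)%MS.
  apply/eqP; rewrite -mxrank_eq0 capmxC.
  have := mxrank_mul_ker V V; rewrite {1}/V -trmx_mul mxrank_tr.
  rewrite mulmxE -exprD rank_add mxrank_tr => /eqP.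
  by rewrite -{2}[\rank B]addn0 eqn_add2l.
have sumUV : (1%:M <= U + V)%MS.
  rewrite sub1mx -col_leq_rank (mxrank_disjoint_sum capUV).
  by rewrite mxrank_ker subnK ?rank_leq_row.
pose Q := proj_mx U V.
have QU x : (x <= U)%MS -> x *m Q = x :> 'rV_n by move/proj_mx_id; apply.
have QV x : (x <= V)%MS -> x *m Q = 0 :> 'rV_n by move/proj_mx_0; apply.
have subQ (x : 'rV[F]_n) : (x *m Q <= U)%MS by apply: proj_mx_sub.
have compl (x : 'rV[F]_n) : (x - x *m Q <= V)%MS.
  by apply: proj_mx_compl_sub; apply: submx_trans sumUV; apply: submx1.
have QQ : Q *m Q = Q by apply: proj_mx_proj.
clearbody Q; exists Q^T; split.
- by rewrite -trmx_mul QQ.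
- move=> x; split=> [[z ->]|Bx0].
    apply: trmx_inj; rewrite !trmx_mul trmxK trmx0.
    by apply/sub_kermxP; apply: subQ.
  exists x; apply: trmx_inj; rewrite trmx_mul trmxK QU//.
  by apply/sub_kermxP; rewrite -trmx_mul Bx0 trmx0.
- move=> x; split=> [Qx0|[z ->]].
    have /submxP[z xz] : (x^T <= V)%MS.
      have := compl x^T; rewrite -[Q]trmxK -trmx_mul Qx0 trmx0 subr0.
      exact.
    by exists z^T; apply: trmx_inj; rewrite trmx_mul trmxK.
  by apply: trmx_inj; rewrite !trmx_mul trmxK trmx0 QV// submxMl.
Qed.

Definition L0_mx (R : realType) (n : nat) (L : 'M[R]_n) : 'M[R]_(n + 1) :=
  block_mx L 0 0 0.

Definition H_mx (R : realType) (n : nat) (delta : R) : 'M[R]_(n + 1) :=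
  delta *: block_mx 1%:M (- const_mx 1) 0 0
  + block_mx 0 0 (- (delta *: const_mx 1)) (delta * n%:R)%:M.

(* y' = M y on [0, +oo[, the derivative at 0 being the right derivative; the
   values of y at negative times are irrelevant. *)
Definition is_solution (R : realType) (m : nat) (M : 'M[R]_m)
    (y : R -> 'cV[R]_m) : Prop :=
  (forall t : R, 0 < t -> is_derive t 1 y (M *m y t)) /\
  h^-1 *: (y h - y 0) @[h --> 0^'+] --> M *m y 0.

Definition col_sum (R : realType) (n : nat) (A : 'M[R]_n) (j : 'I_n) : R :=
  \sum_(i < n) A i j.

(* Main.v *)
(* A = L0 + H is the Laplacian matrix of a graph in which vertex n+1 is joined
   to all others in both directions. Its left null vector p, with entries
   s_j / (n+1) and 1 / (n+1), is a positive probability vector, so c = p y is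
   conserved, and the p-weighted variance V of y about c satisfies
   V' <= - delta V by the Dirichlet form identity for Laplacian matrices: the
   edges into the hub alone already dissipate at rate delta. Hence y tends to
   c 1'.
   For the second limit, N = (I + L / delta)^-1 is row-stochastic, which forces
   ker (L ^ k) = ker L for k >= 1; so N J = J and I - J = L W for some W, and
   N - J = N L W = delta (W - N W) tends to 0. *)
Require Import Defs.
From mathcomp Require Import all_boot all_order all_algebra.
From mathcomp Require Import all_classical all_reals all_analysis.
From mathcomp Require Import ring.

Import Order.TTheory GRing.Theory Num.Theory.
Import numFieldNormedType.Exports.

Local Open Scope classical_set_scope.
Local Open Scope ring_scope.

(** * Derivatives and limits of matrix-valued maps, entry by entry *)

Lemma is_derive_coord (R : realFieldType) (V : normedModType R) (m n : nat)
    (f : V -> 'M[R]_(m, n)) (x v : V) (df : 'M[R]_(m, n))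
    (i : 'I_m) (j : 'I_n) :
  is_derive x v f df -> is_derive x v (fun z => f z i j) (df i j).
Proof.
move=> [f_derivable <-]; apply: DeriveDef.
  by move/derivable_mxP : f_derivable; exact.
by rewrite derive_mx// mxE.
Qed.

Lemma cvg_mx (T : Type) (F : set_system T) (FF : Filter F) (R : realFieldType)
    (m n : nat) (f : T -> 'M[R]_(m, n)) (l : 'M[R]_(m, n)) :
  (forall i j, f x i j @[x --> F] --> l i j) -> f x @[x --> F] --> l.
Proof.
move=> fl; apply/cvgrPdist_le => /= e e0.
near=> x.
rewrite /Num.Def.normr/= mx_normrE (bigmax_le _ (ltW e0))//= => i _.
rewrite !mxE/=.
move: i; near: x; apply: filter_forall => /= i.
exact: ((cvgrPdist_le _ _).1 (fl i.1 i.2)).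
Unshelve. all: by end_near. Qed.

(** * Laplacian matrices: Dirichlet form and minimum principle *)

Section Laplacian.
Variables (R : realType) (n : nat) (L : 'M[R]_n).
Hypothesis L_laplacian : is_laplacian L.

Lemma laplacian_mul1 : L *m const_mx 1 = 0 :> 'cV_n.
Proof.
apply/colP => i; rewrite !mxE -[RHS](L_laplacian.2 i).
by apply: eq_bigr => j _; rewrite mxE mulr1.
Qed.

(** Expanding each square, the u_i^2 terms vanish because the rows of [L] sum to zero and the u_j^2
    terms because p L = 0; only the cross terms remain. *)
Lemma laplacian_dirichlet_form (p : 'rV[R]_n) (u : 'cV[R]_n) : p *m L = 0 ->
  \sum_i p 0 i * (2 * u i 0 * (L *m u) i 0) =
  - \sum_i \sum_j p 0 i * L i j * (u i 0 - u j 0) ^+ 2.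
Proof.
move=> pL0.
have pL j : \sum_i p 0 i * L i j = 0 by move/rowP: pL0 => /(_ j); rewrite !mxE.
have E1 : \sum_i \sum_j p 0 i * L i j * u i 0 ^+ 2 = 0.
  rewrite big1// => i _; rewrite -mulr_suml -mulr_sumr L_laplacian.2.
  by rewrite mulr0 mul0r.
have E2 : \sum_i \sum_j p 0 i * L i j * u j 0 ^+ 2 = 0.
  by rewrite exchange_big big1// => j _; rewrite -mulr_suml pL mul0r.
transitivity (\sum_i p 0 i * (2 * u i 0 * (L *m u) i 0) -
    \sum_i \sum_j p 0 i * L i j * u i 0 ^+ 2 -
    \sum_i \sum_j p 0 i * L i j * u j 0 ^+ 2); first by rewrite E1 E2 !subr0.
rewrite -!sumrB -sumrN; apply: eq_bigr => i _.
rewrite mxE !mulr_sumr -!sumrB -sumrN; apply: eq_bigr => j _.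
ring.
Qed.

(** At an index i where v is smallest, zero row sums give (L v)_i = sum_j L_ij (v_j - v_i) <= 0, so
    the minimum v_i is at least ((I + a L) v)_i >= 0. *)
Lemma laplacian_min_principle (a : R) (v : 'cV[R]_n) : 0 <= a ->
  (forall i, 0 <= ((1%:M + a *: L) *m v) i 0) -> forall i, 0 <= v i 0.
Proof.
move=> a_ge0 Mv_ge0 k.
case: (@arg_minP _ _ _ k predT (fun i => v i 0) isT) => i _ vi.
apply: le_trans (vi k isT); apply: le_trans (Mv_ge0 i) _.
rewrite mulmxDl mul1mx -scalemxAl !mxE gerDl mulr_ge0_le0//.
have -> : \sum_j L i j * v j 0 = \sum_j L i j * (v j 0 - v i 0).
  under [RHS]eq_bigr do rewrite mulrBr.
  by rewrite sumrB -mulr_suml L_laplacian.2 mul0r subr0.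
apply: sumr_le0 => j _; have [->|neq_ij] := eqVneq i j.
  by rewrite subrr mulr0.
by rewrite mulr_le0_ge0 ?L_laplacian.1// subr_ge0; apply: vi.
Qed.

(** * The resolvent N = [invmx M] at a fixed delta > 0 *)

Variable delta : R.
Hypothesis delta_gt0 : 0 < delta.

Let M := 1%:M + delta^-1 *: L.
Let M_unit : M \in unitmx := laplacian_unitmx L_laplacian delta_gt0.

Lemma resolvent_ge0 i j : 0 <= invmx M i j.
Proof.
have -> : invmx M i j = col j (invmx M) i 0 by rewrite mxE.
apply: (@laplacian_min_principle delta^-1); first by rewrite invr_ge0 ltW.
by move=> k; rewrite colE mulmxA mulmxV// mul1mx mxE ler0n.
Qed.

Lemma resolvent_mul1 : invmx M *m const_mx 1 = const_mx 1 :> 'cV_n.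
Proof.
rewrite -[RHS](mulKmx M_unit); congr (_ *m _).
by rewrite mulmxDl mul1mx -scalemxAl laplacian_mul1 scaler0 addr0.
Qed.

Lemma resolvent_le1 i j : invmx M i j <= 1.
Proof.
have /colP/(_ i) := resolvent_mul1; rewrite !mxE => <-.
rewrite (bigD1 j)//= mxE mulr1 lerDl sumr_ge0// => k _.
by rewrite mxE mulr1 resolvent_ge0.
Qed.

Lemma resolvent_row_sum i : \sum_j invmx M i j = 1.
Proof.
have /colP/(_ i) := resolvent_mul1; rewrite !mxE => <-.
by apply: eq_bigr => j _; rewrite mxE mulr1.
Qed.

(** The entries of N lie in [0, 1]. The bound is free of delta, which is what the limits delta -> 0+
    require. *)
Lemma resolvent_norm (w : 'cV[R]_n) i :
  `|(invmx M *m w) i 0| <= \sum_j `|w j 0|.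
Proof.
rewrite mxE (le_trans (ler_norm_sum _ _ _))// ler_sum// => j _.
by rewrite normrM ler_piMl// ger0_norm ?resolvent_ge0// resolvent_le1.
Qed.

(** Multiplying N M = I on the left by the all-ones row gives s M = 1^T, the source of both the
    positivity of s and the left null vector of the coupled matrix. *)
Lemma col_sum_resolvent j :
  \sum_i col_sum (invmx M) i * M i j = 1.
Proof.
have /matrixP/(_ 0 j) : const_mx 1 *m invmx M *m M = const_mx 1 :> 'rV_n.
  by rewrite mulmxKV.
rewrite !mxE => <-; apply: eq_bigr => i _; congr (_ * _).
by rewrite mxE; apply: eq_bigr => k _; rewrite mxE mul1r.
Qed.

(** If s_j were 0, column j of s M would retain only off-diagonal terms s_i M_ij <= 0, yet it equals
    1. *)
Lemma col_sum_resolvent_gt0 j : 0 < col_sum (invmx M) j.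
Proof.
have s_ge0 i : 0 <= col_sum (invmx M) i.
  by apply: sumr_ge0 => k _; apply: resolvent_ge0.
rewrite lt_neqAle s_ge0 andbT; apply/eqP => s0.
have := col_sum_resolvent j.
rewrite (bigD1 j)//= -s0 mul0r add0r => s1.
suff : \sum_(i | i != j) col_sum (invmx M) i * M i j <= 0 by rewrite s1 ler10.
apply: sumr_le0 => i ij; rewrite mulr_ge0_le0// !mxE (negbTE ij) mulr0n add0r.
by rewrite mulr_ge0_le0 ?invr_ge0 ?(ltW delta_gt0)// L_laplacian.1.
Qed.

Lemma sum_col_sum_resolvent : \sum_j col_sum (invmx M) j = n%:R.
Proof.
rewrite exchange_big; under eq_bigr do rewrite resolvent_row_sum.
by rewrite sumr_const card_ord.
Qed.

(** N M = I reads N + N L / delta = I, so N L is delta times I - N, whose action is bounded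
    uniformly in delta. *)
Lemma resolvent_mul_laplacian (w : 'cV[R]_n) :
  invmx M *m (L *m w) = delta *: (w - invmx M *m w).
Proof.
have E : invmx M *m w + delta^-1 *: (invmx M *m (L *m w)) = w.
  rewrite -[RHS](mulKmx M_unit) [X in _ = invmx M *m X]mulmxDl mul1mx.
  by rewrite mulmxDr -scalemxAl -scalemxAr.
rewrite -[X in X - _]E addrAC subrr add0r scalerA mulfV ?gt_eqF//.
by rewrite scale1r.
Qed.

End Laplacian.

(** * Exponential convergence to consensus in the presence of a hub *)

Lemma star_consensus (R : realType) (m : nat) (A : 'M[R]_m) (h : 'I_m) (a : R)
    (p : 'rV[R]_m) (y : R -> 'cV[R]_m) :
  is_laplacian A -> 0 < a -> (forall i, i != h -> A i h <= - a) ->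
  p *m A = 0 -> (forall i, 0 < p 0 i) -> \sum_i p 0 i = 1 ->
  is_solution (- A) y ->
  y t @[t --> +oo] --> (p *m y 0) 0 0 *: const_mx 1.
Proof.
move=> A_laplacian a_gt0 A_hub pA0 p_gt0 p_sum1 [y_derive y_derive0].
set c := (p *m y 0) 0 0.
have y_coord i (t : R) : 0 < t ->
    is_derive t 1 (fun s => y s i 0) (- (A *m y t) i 0).
  move=> t_gt0; have -> : - (A *m y t) i 0 = (- A *m y t) i 0.
    by rewrite mulNmx [RHS]mxE.
  exact/is_derive_coord/y_derive.
pose w (t : R) := \sum_i p 0 i * y t i 0.
have w_derive (t : R) : 0 < t -> is_derive t 1 w 0.
  move=> t_gt0; have -> : w = \sum_i (fun s => p 0 i *: y s i 0).
    by apply/funext => s; rewrite fct_sumE.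
  have -> : 0 = \sum_i p 0 i *: - (A *m y t) i 0.
    under eq_bigr do rewrite scalerN; rewrite sumrN.
    have /matrixP/(_ 0 0) : p *m (A *m y t) = 0 by rewrite mulmxA pA0 mul0mx.
    by rewrite !mxE => ->; rewrite oppr0.
  by apply: is_derive_sum => i; apply: is_deriveZ; exact: y_coord.
have w_cst (s t : R) : 0 < s -> s < t -> w t = w s.
  move=> s_gt0 st; have [||r _ /eqP] := @MVT R w (cst 0) s t st.
  - move=> x; rewrite in_itv/= => /andP[sx _]; apply: w_derive.
    exact: lt_trans sx.
  - apply: derivable_within_continuous => x; rewrite in_itv/= => /andP[sx _].
    by have [] := w_derive x (lt_le_trans s_gt0 sx).
  by rewrite mul0r subr_eq0 => /eqP.
(* At 0 only the right difference quotient is known; multiplied by h it gives right continuity,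
   which identifies the constant value of [w] at positive times as c. *)
have w_right : w t @[t --> 0^'+] --> c.
  have y_right i : y t i 0 @[t --> 0^'+] --> y 0 i 0.
    have h0 : h @[h --> (0:R)^'+] --> (0:R).
      exact: cvg_at_right_filter.
    have q : (h^-1 *: (y h - y 0)) i 0 @[h --> 0^'+] --> (- A *m y 0) i 0.
      apply: (cvg_comp _ (fun M : 'cV[R]_m => M i 0) y_derive0).
      exact: coord_continuous.
    have : h * (h^-1 *: (y h - y 0)) i 0 + y 0 i 0 @[h --> 0^'+] -->
        0 * (- A *m y 0) i 0 + y 0 i 0.
      by apply: cvgD; [exact: cvgM|exact: cvg_cst].
    rewrite mul0r add0r; apply: cvg_trans; apply: near_eq_cvg.
    near=> r; rewrite /= !mxE mulrA mulfV ?mul1r ?subrK//.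
  rewrite /c mxE; apply: cvg_big => [|i _]; first exact: add_continuous.
  apply: cvgMl_tmp.
  exact: y_right.
have wc (t : R) : 0 < t -> w t = c.
  move=> t_gt0.
  apply: (@cvg_unique _ _ (w s @[s --> 0^'+])) => //.
  apply: cvg_near_cst; near=> s; apply/esym/w_cst => //.
pose V (t : R) := \sum_i p 0 i * (y t i 0 - c) ^+ 2.
have V_ge i t : p 0 i * (y t i 0 - c) ^+ 2 <= V t.
  rewrite /V (bigD1 i)//= lerDl sumr_ge0// => j _.
  by rewrite mulr_ge0 ?sqr_ge0// ltW.
pose dV (t : R) := - \sum_i p 0 i * (2 * (y t i 0 - c) * (A *m y t) i 0).
have V_derive (t : R) : 0 < t -> is_derive t 1 V (dV t).
  move=> t_gt0.
  have -> : V = \sum_i (fun s => p 0 i *: (y s i 0 - c) ^+ 2).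
    by apply/funext => s; rewrite fct_sumE.
  rewrite /dV -sumrN; apply: is_derive_sum => i.
  rewrite -mulrN; apply: is_deriveZ.
  have yi := y_coord i t t_gt0.
  have ui : is_derive t 1 (fun s => y s i 0 - c) (- (A *m y t) i 0).
    by apply: is_derive_eq; rewrite subr0.
  by apply: is_derive_eq (is_deriveM ui ui) _; rewrite /GRing.scale/=; ring.
have dV_le (t : R) : 0 < t -> dV t <= - a * V t.
  move=> t_gt0; pose u : 'cV[R]_m := y t - c *: const_mx 1.
  have uE i : u i 0 = y t i 0 - c by rewrite !mxE mulr1.
  have Au : A *m y t = A *m u.
    by rewrite mulmxBr -scalemxAr laplacian_mul1// scaler0 subr0.
  have pu0 : \sum_i p 0 i * u i 0 = 0.
    under eq_bigr do rewrite uE mulrBr; rewrite sumrB -mulr_suml p_sum1 mul1r.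
    by rewrite -/(w t) wc// subrr.
  have -> : dV t = \sum_i \sum_j p 0 i * A i j * (u i 0 - u j 0) ^+ 2.
    rewrite -[RHS]opprK -laplacian_dirichlet_form//; congr (- _).
    by apply: eq_bigr => i _; rewrite uE Au.
  have -> : V t = \sum_i p 0 i * u i 0 ^+ 2.
    by apply: eq_bigr => i _; rewrite uE.
  (* In each row only the term j = h is kept; the discarded ones are nonpositive. *)
  apply: (@le_trans _ _ (\sum_i - a * (p 0 i * (u i 0 - u h 0) ^+ 2))).
    apply: ler_sum => i _.
    have term_le0 j : p 0 i * A i j * (u i 0 - u j 0) ^+ 2 <= 0.
      have [->|ij] := eqVneq i j; first by rewrite subrr expr0n mulr0.
      rewrite mulr_le0_ge0 ?sqr_ge0// mulr_ge0_le0 ?(ltW (p_gt0 i))//.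
      exact: A_laplacian.1.
    rewrite (bigD1 h)//= -[leRHS]addr0 lerD ?sumr_le0//.
    have [->|ih] := eqVneq i h; first by rewrite subrr expr0n !mulr0.
    rewrite [leRHS]mulrA ler_wpM2r ?sqr_ge0// mulrC.
    rewrite ler_wpM2r ?(ltW (p_gt0 i))//.
    exact: A_hub.
  rewrite -mulr_sumr ler_nM2l ?oppr_lt0//.
  (* The p-mean of u is 0, so its spread about u h is at least its variance. *)
  have -> : \sum_i p 0 i * (u i 0 - u h 0) ^+ 2 =
      \sum_i p 0 i * u i 0 ^+ 2 + u h 0 ^+ 2.
    transitivity (\sum_i p 0 i * u i 0 ^+ 2 -
        2 * u h 0 * (\sum_i p 0 i * u i 0) + (\sum_i p 0 i) * u h 0 ^+ 2).
      rewrite mulr_sumr mulr_suml -sumrB -big_split; apply: eq_bigr => i _ /=.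
      ring.
    by rewrite pu0 p_sum1 mulr0 subr0 mul1r.
  by rewrite lerDl sqr_ge0.
(* Integrating factor: W' = exp(a t) (a V + V') <= 0. *)
pose W (t : R) := expR (a * t) * V t.
have W_derive (t : R) : 0 < t ->
    is_derive t 1 W (expR (a * t) * (a * V t + dV t)).
  move=> t_gt0; have Vt := V_derive t t_gt0.
  have et : is_derive t 1 (fun s => expR (a * s)) (expR (a * t) * a).
    apply: is_derive1_comp.
    by apply: is_derive_eq; rewrite [LHS]mulr1.
  apply: (is_derive_eq (is_deriveM et Vt)).
  by rewrite /GRing.scale/=; ring.
(* The derivative of [W] is known only at positive times, so monotonicity is used from time 1 on. *)
have V_decay (t : R) : 1 <= t -> V t <= W 1 * expR (- (a * t)).
  move=> t_ge1; rewrite expRN ler_pdivlMr ?expR_gt0// mulrC -/(W t).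
  have pos x : 1 <= x -> 0 < x :> R by apply: lt_le_trans.
  apply: (@ler0_derive1_nincry _ W 1) => // [x|x|].
  - rewrite in_itv/= andbT => /ltW/pos/W_derive.
    by case.
  - rewrite in_itv/= andbT => /ltW/pos x_gt0; have [_] := W_derive x x_gt0.
    rewrite derive1E => ->; rewrite mulr_ge0_le0 ?expR_ge0//.
    by rewrite addrC -lerBrDr sub0r -mulNr dV_le.
  - apply: derivable_within_continuous => x.
    by rewrite in_itv/= andbT => /pos/W_derive; case.
have V_cvg0 : V t @[t --> +oo] --> 0.
  have aty : a * t @[t --> +oo] --> +oo by apply: gt0_cvgMry.
  have : W 1 * expR (- (a * t)) @[t --> +oo] --> W 1 * 0.
    by apply: cvgMl_tmp; exact: (cvg_comp _ _ aty (@cvgr_expR R)).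
  rewrite mulr0; apply: (squeeze_cvgr _ (cvg_cst 0)).
  near=> t; rewrite V_decay; last by near: t; exact: nbhs_pinfty_ge.
  by rewrite andbT; apply: sumr_ge0 => i _; rewrite mulr_ge0 ?sqr_ge0// ltW.
apply: cvg_mx => i j; rewrite ord1 !mxE mulr1.
apply/cvgrPdist_lt => e e_gt0; near=> t.
rewrite distrC -(@ltr_pXn2r _ 2)// ?nnegrE ?(ltW e_gt0)//.
rewrite real_normK ?num_real//.
(* Since p_i (y_i - c)^2 <= V and p_i > 0, it is enough that V t < p_i e^2. *)
rewrite -(ltr_pM2l (p_gt0 i)) (le_lt_trans (V_ge i t))//.
near: t; apply: cvgr_lt; first exact: V_cvg0.
by rewrite mulr_gt0 ?exprn_gt0.
Unshelve. all: by end_near. Qed.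

(** * The eigenprojection as the limit of the resolvents *)

Section Eigenprojection.
Variables (R : realType) (n : nat) (L J : 'M[R]_n).
Hypothesis L_laplacian : is_laplacian L.
Hypothesis J_eigenprojection : is_eigenprojection L J.

(* If L *m L *m x = 0, then u = L *m x is fixed by every resolvent, while the
   resolvent also maps u to O(delta). *)
Lemma laplacian_sqr_ker (x : 'cV[R]_n) : L *m (L *m x) = 0 -> L *m x = 0.
Proof.
move=> LLx0; apply/colP => i; rewrite [RHS]mxE; apply/normr0_eq0.
apply/eqP; rewrite eq_le normr_ge0 andbT.
(* [K] bounds |(x - N x)_i| for every delta; delta = e / (K + 1) keeps delta K below e, the 1
   guarding against K = 0. *)
set K := `|x i 0| + \sum_j `|x j 0|.
have K1_gt0 : 0 < K + 1 by rewrite ltr_wpDl// addr_ge0// sumr_ge0.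
apply/ler_addgt0Pr => e e_gt0; rewrite add0r.
pose delta := e / (K + 1); have delta_gt0 : 0 < delta by rewrite divr_gt0.
have := resolvent_mul_laplacian _ _ _ L_laplacian _ delta_gt0 (L *m x).
rewrite LLx0 mulmx0 => /esym/eqP; rewrite scaler_eq0 gt_eqF//= subr_eq0.
rewrite resolvent_mul_laplacian// => /eqP ->.
rewrite !mxE normrM gtr0_norm// /delta mulrAC ler_pdivrMr// ler_pM2l//.
rewrite (le_trans (ler_normB _ _))// /K -[leRHS]addrA lerD2l ler_wpDr//.
have := resolvent_norm _ _ _ L_laplacian _ delta_gt0 x i.
by rewrite mxE.
Qed.

(** Surplus factors of [L] are cancelled one at a time by [laplacian_sqr_ker]; thus the range of
    [J], the kernel of a power of [L], lies in ker L. *)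
Lemma laplacian_exp_ker k (x : 'cV[R]_n) : L ^+ k *m x = 0 -> L *m x = 0.
Proof.
elim: k x => [|k IH] x; first by rewrite expr0 mul1mx => ->; rewrite mulmx0.
by rewrite exprSr -mulmxE -mulmxA => /IH/laplacian_sqr_ker.
Qed.

Lemma laplacian_mul_eigenprojection (x : 'cV[R]_n) : L *m (J *m x) = 0.
Proof.
have [_ J_range _] := J_eigenprojection.
by apply: laplacian_exp_ker; apply/J_range; exists x.
Qed.

(** x - J x lies in ker J, the range of L^nu; for nu >= 1 one factor [L] is split off. *)
Lemma eigenprojection_compl (x : 'cV[R]_n) :
  exists w : 'cV[R]_n, x - J *m x = L *m w.
Proof.
have [JJ _ J_ker] := J_eigenprojection.
have /J_ker[z ->] : J *m (x - J *m x) = 0 by rewrite mulmxBr mulmxA JJ subrr.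
rewrite /mx_index; case: ex_minnP => -[|k] /eqP rank_eq _; last first.
  by exists (L ^+ k *m z); rewrite mulmxA mulmxE -exprS.
(* Index 0: [L] has the rank of L^0 = I, so it is invertible and z = L (L^-1 z). *)
exists (invmx L *m z); rewrite expr0 mul1mx mulKVmx// -row_free_unit /row_free.
by move: rank_eq; rewrite expr1 expr0 mxrank1 => ->.
Qed.

Lemma cvg_resolvent i j :
  invmx (1%:M + delta^-1 *: L) i j @[delta --> 0^'+] --> J i j.
Proof.
have [w Ew] := eigenprojection_compl (delta_mx j 0).
(* The same [w] and [K] serve every delta: column j of N - J is N L w = delta (w - N w), and |(w - N
   w)_i| <= K. *)
set K := `|w i 0| + \sum_k `|w k 0|.
have Kcvg : delta * K @[delta --> (0:R)^'+] --> (0:R).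
  rewrite -[X in _ --> X](mul0r K).
  by apply: cvgMr_tmp; exact: cvg_at_right_filter.
apply/cvgrPdist_lt => e e_gt0; near=> delta.
have delta_gt0 : 0 < delta by [].
have NJ : invmx (1%:M + delta^-1 *: L) *m (J *m delta_mx j 0) =
    J *m delta_mx j 0 :> 'cV[R]_n.
  have := resolvent_mul_laplacian _ _ _ L_laplacian _ delta_gt0
    (J *m delta_mx j 0).
  rewrite laplacian_mul_eigenprojection mulmx0 => /esym/eqP.
  by rewrite scaler_eq0 gt_eqF//= subr_eq0 => /eqP.
have -> : J i j - invmx (1%:M + delta^-1 *: L) i j =
    - (delta *: (w - invmx (1%:M + delta^-1 *: L) *m w)) i 0.
  rewrite -resolvent_mul_laplacian// -Ew mulmxBr NJ -!colE !mxE.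
  by rewrite opprB.
rewrite normrN !mxE normrM gtr0_norm//.
apply: (@le_lt_trans _ _ (delta * K)).
  rewrite ler_pM2l// (le_trans (ler_normB _ _))// lerD2l.
  have := resolvent_norm _ _ _ L_laplacian _ delta_gt0 w i.
  by rewrite mxE.
by near: delta; exact: (cvgr_lt _ Kcvg).
Unshelve. all: by end_near. Qed.

End Eigenprojection.

(** * The coupled matrix of order n + 1 and its left null vector *)

Section Coupled.
Variables (R : realType) (n : nat) (L : 'M[R]_n) (delta : R).
Hypothesis L_laplacian : is_laplacian L.
Hypothesis delta_gt0 : 0 < delta.

Let A := L0_mx L + H_mx n delta.
Let s := col_sum (invmx (1%:M + delta^-1 *: L)).

(** The upper left block L + delta I is written as delta M, so that the identities for N = M^-1
    apply to it directly. *)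
Lemma coupled_mxE :
  (forall i j, A (lshift 1 i) (lshift 1 j) =
     delta * (1%:M + delta^-1 *: L) i j) *
  (forall i l, A (lshift 1 i) (rshift n l) = - delta) *
  (forall k j, A (rshift n k) (lshift 1 j) = - delta) *
  (forall k l, A (rshift n k) (rshift n l) = delta * n%:R).
Proof.
rewrite /A /L0_mx /H_mx scale_block_mx !add_block_mx.
split; [split; [split|]|] => i j;
  rewrite (block_mxEul, block_mxEur, block_mxEdl, block_mxEdr) !mxE; last first.
- by rewrite (ord1 i) (ord1 j) eqxx mulr1n mulr0 !add0r.
- ring.
- ring.
by rewrite [RHS]mulrDr mulVKf ?(gt_eqF delta_gt0)// addr0 addrC.
Qed.

Lemma coupled_laplacian : is_laplacian A.
Proof.
split=> i; last first.
  rewrite big_split_ord/= big_ord1; case: (split_ordP i) => k ->.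
    under eq_bigr do rewrite coupled_mxE.
    rewrite coupled_mxE -mulr_sumr.
    have -> : \sum_j (1%:M + delta^-1 *: L) k j = 1.
      under eq_bigr do rewrite !mxE.
      rewrite big_split/= -mulr_sumr L_laplacian.2 mulr0 addr0.
      rewrite (bigD1 k)//= eqxx big1 ?addr0// => j /negbTE.
      by rewrite eq_sym => ->.
    by rewrite mulr1 subrr.
  under eq_bigr do rewrite coupled_mxE.
  by rewrite coupled_mxE sumr_const card_ord mulNrn mulr_natr addNr.
move=> j; case: (split_ordP i) => k ->; case: (split_ordP j) => l ->.
- rewrite (inj_eq (@lshift_inj _ _)) coupled_mxE => kl.
  rewrite !mxE (negbTE kl) add0r pmulr_rle0// pmulr_rle0 ?invr_gt0//.
  exact: L_laplacian.1.
- by rewrite coupled_mxE oppr_le0 ltW.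
- by rewrite coupled_mxE oppr_le0 ltW.
- by rewrite (ord1 k) (ord1 l) eqxx.
Qed.

Definition coupled_weight : 'rV[R]_(n + 1) :=
  (n + 1)%:R^-1 *: row_mx (\row_j s j) (const_mx 1).

Lemma coupled_weightE :
  (forall j, coupled_weight 0 (lshift 1 j) = (n + 1)%:R^-1 * s j) *
  (forall k, coupled_weight 0 (rshift n k) = (n + 1)%:R^-1).
Proof.
by split=> k; rewrite mxE ?row_mxEl ?row_mxEr mxE ?mulr1.
Qed.

Lemma coupled_weight_gt0 i : 0 < coupled_weight 0 i.
Proof.
have n1_gt0 : 0 < (n + 1)%:R^-1 :> R by rewrite invr_gt0 ltr0n addn1.
case: (split_ordP i) => k ->; rewrite coupled_weightE// mulr_gt0//.
exact: col_sum_resolvent_gt0.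
Qed.

Lemma coupled_weight_sum : \sum_i coupled_weight 0 i = 1.
Proof.
rewrite big_split_ord/= big_ord1; under eq_bigr do rewrite coupled_weightE.
rewrite coupled_weightE -mulr_sumr sum_col_sum_resolvent//.
by rewrite -[X in _ + X]mulr1 -mulrDr natr1 addn1 mulVf// pnatr_eq0.
Qed.

(** Up to the factor 1 / (n + 1), column j <= n gives delta (s M)_j - delta = 0 and the hub column
    gives - delta sum_j s_j + delta n = 0. *)
Lemma coupled_weight_ker : coupled_weight *m A = 0.
Proof.
apply/rowP => j; rewrite mxE [RHS]mxE big_split_ord/= big_ord1.
case: (split_ordP j) => l ->.
  under eq_bigr do rewrite coupled_weightE coupled_mxE mulrACA.
  rewrite coupled_weightE coupled_mxE -mulr_sumr col_sum_resolvent//.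
  by rewrite mulr1 mulrN subrr.
under eq_bigr do rewrite coupled_weightE coupled_mxE mulrAC.
rewrite coupled_weightE coupled_mxE -mulr_sumr sum_col_sum_resolvent//.
ring.
Qed.

Lemma coupled_weight_mul (x : 'cV[R]_(n + 1)) :
  (coupled_weight *m x) 0 0 = (n + 1)%:R^-1 *
    (\sum_j s j * x (lshift 1 j) 0 + x (rshift n 0) 0).
Proof.
rewrite mxE big_split_ord/= big_ord1 coupled_weightE mulrDr mulr_sumr.
by under eq_bigr do rewrite coupled_weightE -mulrA.
Qed.

End Coupled.

(** * Passage to the limits t -> +oo and then delta -> 0+ *)

Theorem proposition2 (R : realType) (n : nat) (L J : 'M[R]_n)
    (L_laplacian : is_laplacian L) (J_eigenprojection : is_eigenprojection L J)
    (y0 : 'cV[R]_(n + 1)) (y : R -> R -> 'cV[R]_(n + 1))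
    (y_solution : forall delta : R, 0 < delta ->
       is_solution (- (L0_mx L + H_mx n delta)) (y delta))
    (y_init : forall delta : R, 0 < delta -> y delta 0 = y0) :
  (forall delta : R, 0 < delta ->
     y delta t @[t --> +oo] -->
       ((n + 1)%:R^-1 *
        (\sum_(j < n) col_sum (invmx (1%:M + delta^-1 *: L)) j
                      * y0 (lshift 1 j) 0
         + y0 (rshift n 0) 0)) *: (const_mx 1 : 'cV[R]_(n + 1))) /\
  lim (y delta t @[t --> +oo]) @[delta --> 0^'+] -->
    ((n + 1)%:R^-1 *
     (\sum_(j < n) col_sum J j * y0 (lshift 1 j) 0
      + y0 (rshift n 0) 0)) *: (const_mx 1 : 'cV[R]_(n + 1)).
Proof.
have y_cvg (delta : R) : 0 < delta -> y delta t @[t --> +oo] -->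
       ((n + 1)%:R^-1 *
        (\sum_(j < n) col_sum (invmx (1%:M + delta^-1 *: L)) j
                      * y0 (lshift 1 j) 0
         + y0 (rshift n 0) 0)) *: (const_mx 1 : 'cV[R]_(n + 1)).
  move=> delta_gt0; rewrite -coupled_weight_mul -(y_init delta)//.
  (* The hub is vertex n + 1, to which every other vertex is tied with weight exactly delta. *)
  apply: (star_consensus _ _ _ (rshift n 0) delta)
    (y_solution delta delta_gt0) => //.
  - exact: coupled_laplacian.
  - move=> i; case: (split_ordP i) => k ->; first by rewrite coupled_mxE.
    by rewrite (ord1 k) eqxx.
  - exact: coupled_weight_ker.
  - exact: coupled_weight_gt0.
  - exact: coupled_weight_sum.
split=> //.
(* The inner limit has its explicit value only for delta > 0, hence eventually along [0^'+], which
   is enough for the outer limit. *)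
have lim_y : \forall delta \near 0^'+, ((n + 1)%:R^-1 *
    (\sum_(j < n) col_sum (invmx (1%:M + delta^-1 *: L)) j
                  * y0 (lshift 1 j) 0
     + y0 (rshift n 0) 0)) *: (const_mx 1 : 'cV[R]_(n + 1)) =
    lim (y delta t @[t --> +oo]).
  near=> delta; apply/esym/cvg_lim; first exact: norm_hausdorff.
  exact: y_cvg.
apply: cvg_trans (near_eq_cvg lim_y) _.
apply: cvg_mx => i k; rewrite !mxE.
under eq_fun do rewrite !mxE.
apply: cvgMr_tmp; apply: cvgMl_tmp; apply: cvgD; last exact: cvg_cst.
apply: cvg_big => [|j _]; first exact: add_continuous.
apply: cvgMr_tmp; apply: cvg_big => [|l _]; first exact: add_continuous.
exact: cvg_resolvent.
Unshelve. all: by end_near. Qed.
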